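(* $D_T^{(2,2)} = 110$. Moreover, for every prime integer $p \geq 3$, the number $D_T^{(p,p)}$ of toroidal knot $(p,p)$-mosaics is $$D_T^{(p,p)} = \frac{1}{p^2}\, d_{p^2} + \frac{2}{p} \sum_{k=0}^{\frac{p-1}{2}} d_{p_{(k,1)}} + 7,$$ where the positive integers $d_{p_{(k,1)}}$ and $d_{p^2}$ are defined by $$d_{p_{(k,1)}} = \mathrm{tr}^{(k)}(X_p^{+} + O_p^{+}) - 7 \quad\text{and}\quad d_{p^2} = D_{P}^{(p,p)} - 2 \sum_{k=0}^{\frac{p-1}{2}} d_{p_{(k,1)}} - 7.$$ Here $D_P^{(p,p)}$ is the number of period knot $(p,p)$-mosaics, $X_p^+$ and $O_p^+$ are the $2^p\times 2^p$ matrices defined recursively in the context, and for a $2^p\times 2^p$ matrix $A$, $\mathrm{tr}^{(k)}(A)$ is the sum over $i=0,\dots,2^p-1$ of the $(i+1,\alpha(i)+1)$-entries of $A$, where $\alpha(i)\equiv 2^k i \pmod{2^p-1}$ with $0 \le \alpha(i) \le 2^p-2$ for $0\le i\le 2^p-2$, and $\alpha(2^p-1)=2^p-1$.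
   Context: Mosaic tiles: there are eleven tiles $T_0,\dots,T_{10}$ (unit squares with curves drawn on them). A connection point of a tile is the midpoint of an edge (left, right, top, bottom) of the tile that is an endpoint of a curve drawn on the tile. The sets of edges carrying connection points are as follows: $T_0$: none; $T_1$: left, bottom; $T_2$: right, bottom; $T_3$: right, top; $T_4$: left, top; $T_5$: left, right; $T_6$: top, bottom; $T_7,T_8,T_9,T_{10}$: all four edges. Thus each two-element set of edges occurs for exactly one tile, the empty set for exactly one tile, and the full set for exactly four (distinct) tiles. For positive integers $m,n$, an $(m,n)$-mosaic is an $m\times n$ matrix $M=(M_{ij})$ of mosaic tiles (row 1 at the top, column 1 at the left). It is suitably connected if any two tiles immediately next to each other in the same row or the same column either both have or both do not have a connection point on their common edge. It is suitably $\partial$-connected if for each row, the leftmost tile has a connection point on its left edge if and only if the rightmost tile has one on its right edge, and for each column, the topmost tile has a connection point on its top edge if and only if the bottommost tile has one on its bottom edge. A period knot $(m,n)$-mosaic is a suitably connected and suitably $\partial$-connected $(m,n)$-mosaic; $D_P^{(m,n)}$ denotes the number of these. Two period knot $(m,n)$-mosaics are equivalent if one can be obtained from the other by a finite sequence of cyclic rotations of rows and columns, i.e. if for some integers $x,y$ one is $(M_{ij})$ and the other is $(M_{i-x,j-y})$, with row indices taken modulo $m$ and column indices modulo $n$. (Tiles themselves are not rotated.) A toroidal knot $(m,n)$-mosaic is an equivalence class of period knot $(m,n)$-mosaics; $D_T^{(m,n)}$ denotes the number of these classes. The $2^k\times 2^k$ matrices $X_k^{\pm}, O_k^{\pm}$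 are defined by $X_0^+ = O_0^+ = \begin{bmatrix} 1 \end{bmatrix}$, $X_0^- = O_0^- = \begin{bmatrix} 0 \end{bmatrix}$ and, for $k\ge 0$, in block form, $$ X_{k+1}^+ = \begin{bmatrix} X_k^+ & O_k^- \\ O_k^- & X_k^+ \end{bmatrix}, \quad X_{k+1}^- = \begin{bmatrix} X_k^- & O_k^+ \\ O_k^+ & X_k^- \end{bmatrix}, \quad O_{k+1}^+ = \begin{bmatrix} O_k^+ & X_k^- \\ X_k^- & 4\, O_k^+ \end{bmatrix}, \quad O_{k+1}^- = \begin{bmatrix} O_k^- & X_k^+ \\ X_k^+ & 4\, O_k^- \end{bmatrix}. $$ *)

(* Defs.v *)
From HB Require Import structures.
From mathcomp Require Import all_boot all_order all_algebra.

Set Implicit Arguments.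
Unset Strict Implicit.
Unset Printing Implicit Defensive.
Import Order.TTheory GRing.Theory Num.Theory.
Local Open Scope ring_scope.

(* The ordinal [t] stands for the tile T_t. Of the drawn curves only the set of
   edges carrying connection points matters, but the four tiles T_7, ..., T_10
   (all four edges) are distinct. *)
Definition tile := 'I_11.

Definition conn_left (t : tile) : bool :=
  (t : nat) \in [:: 1; 4; 5; 7; 8; 9; 10]%N.
Definition conn_right (t : tile) : bool :=
  (t : nat) \in [:: 2; 3; 5; 7; 8; 9; 10]%N.
Definition conn_top (t : tile) : bool :=
  (t : nat) \in [:: 3; 4; 6; 7; 8; 9; 10]%N.
Definition conn_bottom (t : tile) : bool :=
  (t : nat) \in [:: 1; 2; 6; 7; 8; 9; 10]%N.

(* Rows are numbered from the top and columns from the left, starting at 0. *)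
Definition mosaic (m n : nat) := 'M[tile]_(m, n).

Definition suitably_connected (m n : nat) (M : mosaic m n) : bool :=
  [forall i : 'I_m, forall j : 'I_n, forall j' : 'I_n,
     (j' == j.+1 :> nat) ==> (conn_right (M i j) == conn_left (M i j'))]
  && [forall i : 'I_m, forall i' : 'I_m, forall j : 'I_n,
     (i' == i.+1 :> nat) ==> (conn_bottom (M i j) == conn_top (M i' j))].

Definition suitably_bd_connected (m n : nat) (M : mosaic m n) : bool :=
  [forall i : 'I_m, forall j : 'I_n, forall j' : 'I_n,
     ((j == 0 :> nat) && (j'.+1 == n :> nat)) ==>
       (conn_left (M i j) == conn_right (M i j'))]
  && [forall i : 'I_m, forall i' : 'I_m, forall j : 'I_n,
     ((i == 0 :> nat) && (i'.+1 == m :> nat)) ==>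
       (conn_top (M i j) == conn_bottom (M i' j))].

Definition period_mosaics (m n : nat) : {set mosaic m n} :=
  [set M : mosaic m n | suitably_connected M && suitably_bd_connected M].

Definition D_P (m n : nat) : nat := #|period_mosaics m n|.

Lemma cyc_sub_subproof (n : nat) (i : 'I_n) (x : int) :
  (`|((i%:Z - x) %% n%:Z)%Z| < n)%N.
Proof.
have n_gt0 : (0 < n)%N by apply: leq_ltn_trans (ltn_ord i).
have n_neq0 : n%:Z != 0 by rewrite eqz_nat -lt0n.
by rewrite -ltz_nat gez0_abs ?modz_ge0 // ltz_pmod // ltz_nat.
Qed.

(* The index i - x modulo n. *)
Definition cyc_sub (n : nat) (i : 'I_n) (x : int) : 'I_n :=
  Ordinal (cyc_sub_subproof i x).

Definition rotate (m n : nat) (x y : int) (M : mosaic m n) : mosaic m n :=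
  \matrix_(i < m, j < n) M (cyc_sub i x) (cyc_sub j y).

(* For a decidable relation, the rotation amounts range over residues; see
   [toroidal_equivP] for arbitrary integer amounts. *)
Definition toroidal_equiv (m n : nat) : rel (mosaic m n) :=
  fun M N => [exists x : 'I_m, exists y : 'I_n, N == rotate x%:Z y%:Z M].

Lemma cyc_sub_mod (n : nat) (i : 'I_n) (x : int) :
  cyc_sub i (x %% n%:Z)%Z = cyc_sub i x.
Proof.
by apply: val_inj; rewrite /= -modzDmr -[in RHS]modzDmr modzNm.
Qed.

Lemma toroidal_equivP (m n : nat) (M N : mosaic m n) :
  (0 < m)%N -> (0 < n)%N ->
  reflect (exists x y : int, N = rotate x y M) (toroidal_equiv M N).
Proof.
move=> m_gt0 n_gt0; apply: (iffP existsP) => [[x /existsP[y /eqP->]]|].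
  by exists x%:Z, y%:Z.
have residue k (z : int) : (0 < k)%N -> exists r : 'I_k, r%:Z = (z %% k%:Z)%Z.
  move=> k_gt0; have k_neq0 : k%:Z != 0 by rewrite eqz_nat -lt0n.
  have r_ge0 : 0 <= (z %% k%:Z)%Z by rewrite modz_ge0.
  have ltr : (`|(z %% k%:Z)%Z| < k)%N.
    by rewrite -ltz_nat gez0_abs // ltz_pmod // ltz_nat.
  by exists (Ordinal ltr); rewrite /= gez0_abs.
move=> [x [y ->]].
have [[rx Ex] [ry Ey]] := (residue m x m_gt0, residue n y n_gt0).
exists rx; apply/existsP; exists ry; apply/eqP/matrixP => i j.
by rewrite !mxE Ex Ey !cyc_sub_mod.
Qed.

Definition toroidal_mosaics (m n : nat) : {set {set mosaic m n}} :=
  equivalence_partition (@toroidal_equiv m n) (period_mosaics m n).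

Definition D_T (m n : nat) : nat := #|toroidal_mosaics m n|.

Lemma expn2_double (k : nat) : (2 ^ k + 2 ^ k = 2 ^ k.+1)%N.
Proof. by rewrite expnS mul2n addnn. Qed.

Definition block2 (k : nat) (A B C D : 'M[int]_(2 ^ k)) : 'M[int]_(2 ^ k.+1) :=
  castmx (expn2_double k, expn2_double k) (block_mx A B C D).

Fixpoint Xplus (k : nat) : 'M[int]_(2 ^ k) :=
  if k is k'.+1 then block2 (Xplus k') (Ominus k') (Ominus k') (Xplus k')
  else const_mx 1
with Ominus (k : nat) : 'M[int]_(2 ^ k) :=
  if k is k'.+1 then block2 (Ominus k') (Xplus k') (Xplus k') (4 *: Ominus k')
  else const_mx 0.

Fixpoint Xminus (k : nat) : 'M[int]_(2 ^ k) :=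
  if k is k'.+1 then block2 (Xminus k') (Oplus k') (Oplus k') (Xminus k')
  else const_mx 0
with Oplus (k : nat) : 'M[int]_(2 ^ k) :=
  if k is k'.+1 then block2 (Oplus k') (Xminus k') (Xminus k') (4 *: Oplus k')
  else const_mx 1.

(* As a map of p-bit words, multiplication by 2^k modulo 2^p - 1 rotates the bits
   by k places; the all-ones word 2^p - 1 is fixed. *)
Definition alpha_nat (p k i : nat) : nat :=
  if (i < 2 ^ p - 1)%N then ((2 ^ k * i) %% (2 ^ p - 1))%N else i.

Lemma alpha_subproof (p k : nat) (i : 'I_(2 ^ p)) : (alpha_nat p k i < 2 ^ p)%N.
Proof.
rewrite /alpha_nat; case: ifP => // lti; have q_gt0 := leq_ltn_trans (leq0n _) lti.
by apply: leq_trans (ltn_pmod _ q_gt0) (leq_subr _ _).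
Qed.

Definition alpha (p k : nat) (i : 'I_(2 ^ p)) : 'I_(2 ^ p) :=
  Ordinal (alpha_subproof k i).

(* The shifted trace tr^(k) of a 2^p x 2^p matrix; for k = 0 it is the trace. *)
Definition shifted_trace (p k : nat) (A : 'M[int]_(2 ^ p)) : int :=
  \sum_(i < 2 ^ p) A i (alpha k i).

(* d_{p_(k,1)}. *)
Definition d_k1 (p k : nat) : int := shifted_trace k (Xplus p + Oplus p) - 7.

(* d_{p^2}. *)
Definition d_sq (p : nat) : int :=
  (D_P p p)%:Z - 2 * (\sum_(0 <= k < ((p - 1) %/ 2).+1) d_k1 p k) - 7.

(* Main.v *)
Require Import Defs.
From mathcomp Require Import all_boot all_order all_algebra all_fingroup.
From mathcomp Require Import zify ring.

Set Implicit Arguments.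
Unset Strict Implicit.
Unset Printing Implicit Defensive.
Import Order.TTheory GRing.Theory Num.Theory.
Local Open Scope ring_scope.

(** The toroidal mosaics are the orbits of the translation group G = (Z/p)^2 on
the period mosaics, so Burnside's lemma ([toroidal_burnside]) gives
<<
  p^2 D_T = sum over g in G of the number of period mosaics fixed by g.
>>
For p prime, a nonzero g generates the same subgroup as exactly one of the p + 1
directions (1, y), for y in Z/p, and (0, 1), and it fixes the same mosaics as
that direction; the identity fixes all D_P mosaics. Hence
[sum_card_fixed]: the sum is D_P + (p - 1) times the sum over directions.

A mosaic fixed by (1, y) is an infinite helix: it is determined by one row s,
and the conditions on s are that its tiles match cyclically and that its top
edges are its bottom edges rotated by y places ([card_fixed_helix]). The state
matrices X_p^+ and O_p^+ count the rows with prescribed bottom and top edges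
whose two outer vertical edges agree, without or with a connection point
([state_matrixE]); as alpha rotates binary words ([alpha_rot]), the shifted
trace of X_p^+ + O_p^+ is exactly the number of such rows ([shifted_traceE]).

Transposing the torus exchanges the directions (0, 1) and (1, 0), and a
reflection exchanges (1, y) and (1, -y), so for p odd the p + 1 directions give
each of the shifted traces for k = 0, ..., (p - 1)/2 exactly twice
([sum_fixed_direction]). With t_k for the k-th shifted trace,
<<
  p^2 D_T = D_P + 2 (p - 1) sum_k t_k,
>>
which is the claimed formula once t_k = d_{p_(k,1)} + 7 is substituted.

The number 7 is the number of constant period mosaics, which are the mosaics
fixed by two different directions. So d_{p_(k,1)} counts the non-constant
mosaics fixed by (1, k), and d_{p^2} counts the mosaics with trivial stabilizer.
Both are positive because the tiles T_7 and T_8 can be mixed freely: a single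
helix of T_7 among T_8, respectively a single T_7 among T_8, is such a mosaic.

The same group identity for p = 2 has four terms, each of which is a count over
four tiles: 4 D_T = 359 + 29 + 29 + 23 = 440. *)

(** * Binary words as matrix indices *)

(** The first letter is the most significant bit: it selects the block in the
outermost block decomposition of the state matrices, which describes the
leftmost tile of a row. *)
Fixpoint word_val (w : seq bool) : nat :=
  if w is b :: w' then (b * 2 ^ size w' + word_val w')%N else 0%N.

Lemma word_val_lt (w : seq bool) : (word_val w < 2 ^ size w)%N.
Proof.
elim: w => //= b w IHw; rewrite expnS mul2n -addnn -addnS leq_add //.
by case: b; rewrite ?mul1n ?mul0n.
Qed.

Lemma word_ord_subproof (p : nat) (w : p.-tuple bool) : (word_val w < 2 ^ p)%N.
Proof. by have := word_val_lt w; rewrite size_tuple. Qed.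

Definition word_ord (p : nat) (w : p.-tuple bool) : 'I_(2 ^ p) :=
  Ordinal (word_ord_subproof w).

Lemma word_val_inj (v w : seq bool) :
  size v = size w -> word_val v = word_val w -> v = w.
Proof.
elim: v w => [|b v IHv] [|c w] //= [szvw]; rewrite szvw => Evw.
have Ebc : b = c.
  have ltv := word_val_lt v; have ltw := word_val_lt w; rewrite szvw in ltv.
  by case: b c Evw => [] [] //=; lia.
rewrite Ebc in Evw *; congr (_ :: _); apply: IHv => //.
by apply/eqP; rewrite -(eqn_add2l (c * 2 ^ size w)) Evw.
Qed.

Lemma word_ord_bij (p : nat) : bijective (@word_ord p).
Proof.
apply: inj_card_bij; last by rewrite card_tuple card_bool card_ord.
move=> v w [Evw]; apply: val_inj; apply: word_val_inj => //.
by rewrite !size_tuple.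
Qed.

Lemma word_val_rcons (w : seq bool) (b : bool) :
  word_val (rcons w b) = (word_val w * 2 + b)%N.
Proof.
elim: w => [|c w IHw] /=; first by rewrite muln1 addn0.
by rewrite IHw size_rcons expnSr mulnA mulnDl addnA.
Qed.

(** Doubling the value of [b :: w] gives twice the value of [w] plus [b * 2 ^ p],
and modulo [2 ^ p - 1] the weight [2 ^ p] of the overflowing bit becomes 1: that
bit reappears at the other end. The all-ones word is the only one for which the
reduction would fail, and it is invariant under rotation. *)
Lemma alpha_rot1 (p : nat) (w : p.-tuple bool) :
  alpha 1 (word_ord w) = word_ord (rot_tuple 1 w).
Proof.
apply: val_inj; rewrite /= /alpha_nat /= expn1.
case: p w => [|p] w; first by rewrite tuple0.
case: w => [[|b w] //= szw]; rewrite rot1_cons word_val_rcons.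
have {szw} szw : size w = p by case/eqP: szw.
rewrite szw; have ltw := word_val_lt w; rewrite szw in ltw.
have q_gt0 : (0 < 2 ^ p)%N by rewrite expn_gt0.
rewrite expnS; case: b => /=; rewrite ?mul1n ?mul0n ?add0n ?addn0.
  case: ifP => [lt_i|ge_i].
    have -> : (2 * (2 ^ p + word_val w) = (2 * 2 ^ p - 1) + (word_val w * 2 + 1))%N.
      by lia.
    rewrite modnDl modn_small //; lia.
  lia.
case: ifP => lt_i; last by lia.
rewrite modn_small; lia.
Qed.

Lemma alphaS (p k : nat) (i : 'I_(2 ^ p)) : alpha k.+1 i = alpha 1 (alpha k i).
Proof.
apply: val_inj; rewrite /= /alpha_nat; case: (ltnP i (2 ^ p - 1)) => [lti|gei].
  have q_gt0 := leq_ltn_trans (leq0n i) lti.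
  by rewrite ltn_pmod // modnMmr mulnA -expnD add1n.
by rewrite ltnNge gei.
Qed.

Lemma alpha_rot (p k : nat) (w : p.-tuple bool) :
  (k <= p)%N -> alpha k (word_ord w) = word_ord (rot_tuple k w).
Proof.
elim: k => [|k IHk] lekp.
  apply: val_inj; rewrite /= /alpha_nat rot0 expn0 mul1n; case: ifP => // lt_i.
  by rewrite modn_small.
rewrite alphaS IHk 1?ltnW // alpha_rot1; congr word_ord; apply: val_inj => /=.
by rewrite -rotS // size_tuple.
Qed.

(** * State matrices count rows of tiles *)

(** Every tile carries an even number of connection points. Hence three edges of a
tile determine the fourth. *)
Lemma conn_parity (t : tile) :
  conn_right t = conn_left t (+) conn_bottom t (+) conn_top t.
Proof. by case: t; do 11?[case=> //]. Qed.

(** This is where the factor 4 of the recursion for O comes from: three prescribed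
connection points force one of T_7, ..., T_10. *)
Lemma card_tile (l a b : bool) :
  #|[set t | [&& conn_left t == l, conn_bottom t == a & conn_top t == b]]|
    = (if [&& l, a & b] then 4 else 1)%N.
Proof.
rewrite cardsE -sum1_card big_mkcond /= !big_ord_recl big_ord0.
by case: l; case: a; case: b.
Qed.

(** The equation between sequences says at once that the outer left edge is [l],
that the outer right edge is [r], and that neighbouring tiles match. *)
Definition row_count (p : nat) (l r : bool) (a b : seq bool) : nat :=
  #|[set s : p.-tuple tile | [&& l :: map conn_right s == rcons (map conn_left s) r,
       map conn_bottom s == a & map conn_top s == b]]|.

Lemma row_count0 (l r : bool) : row_count 0 l r [::] [::] = (l == r).
Proof.
rewrite /row_count; case: eqVneq => [->|neq_lr].
  rewrite (_ : [set _ | _] = setT) ?cardsT ?card_tuple ?expn0 //.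
  by apply/setP => s; rewrite !inE tuple0 /= eqxx.
rewrite (_ : [set _ | _] = set0) ?cards0 //.
by apply/setP => s; rewrite !inE tuple0 /= eqseq_cons (negPf neq_lr).
Qed.

Lemma row_countS (p : nat) (l r a0 b0 : bool) (a b : seq bool) :
  row_count p.+1 l r (a0 :: a) (b0 :: b) =
    ((if [&& l, a0 & b0] then 4 else 1) * row_count p (l (+) a0 (+) b0) r a b)%N.
Proof.
rewrite -card_tile /row_count -cardsX.
rewrite -[RHS](card_imset
  (f := fun ts : tile * p.-tuple tile => [tuple of ts.1 :: ts.2])); last first.
  by move=> [t s] [t' s'] /= [-> /val_inj->].
apply: eq_card => s; apply/idP/imsetP => [|[[t s'] + ->]].
  case/tupleP: s => t s; rewrite !inE /= !eqseq_cons => /and3P[].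
  move=> /andP[/eqP-> Ers] /andP[/eqP Ea0 Ea] /andP[/eqP Eb0 Eb].
  exists (t, s) => //; rewrite !inE /= Ea0 Eb0 Ea Eb !eqxx /= andbT.
  by rewrite -Ea0 -Eb0 -conn_parity.
rewrite !inE /= !eqseq_cons => /andP[/and3P[/eqP<- /eqP<- /eqP<-]].
by rewrite -conn_parity !eqxx => /and3P[-> -> ->].
Qed.

Lemma word_ord_cons (k : nat) (b : bool) (w : k.-tuple bool) :
  word_ord [tuple of b :: w] =
    cast_ord (expn2_double k)
      (if b then rshift (2 ^ k) (word_ord w) else lshift (2 ^ k) (word_ord w)).
Proof. by apply: val_inj; case: b; rewrite /= ?mul0n ?mul1n ?size_tuple. Qed.

Lemma block2E (k : nat) (A B C D : 'M[int]_(2 ^ k)) (a b : bool) (v w : k.-tuple bool) :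
  block2 A B C D (word_ord [tuple of a :: v]) (word_ord [tuple of b :: w]) =
    (if a then if b then D else C else if b then B else A) (word_ord v) (word_ord w).
Proof.
rewrite /block2 !word_ord_cons castmxE !cast_ordK.
by case: a; case: b; rewrite (block_mxEul, block_mxEur, block_mxEdl, block_mxEdr).
Qed.

(** The letter X or O records the outer left edge, without or with a connection
point; the sign + says that the outer right edge agrees with it. The recursion is
the removal of the leftmost tile, [row_countS]. *)
Lemma state_matrixE (p : nat) (v w : p.-tuple bool) :
  [/\ Xplus p (word_ord v) (word_ord w) = (row_count p false false v w)%:Z,
      Ominus p (word_ord v) (word_ord w) = (row_count p true false v w)%:Z,
      Xminus p (word_ord v) (word_ord w) = (row_count p false true v w)%:Z
    & Oplus p (word_ord v) (word_ord w) = (row_count p true true v w)%:Z].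
Proof.
elim: p v w => [|p IHp] v w.
  by rewrite (tuple0 v) (tuple0 w) !row_count0 !mxE.
case/tupleP: v => a v; case/tupleP: w => b w.
rewrite /= !block2E !row_countS; case: (IHp v w) => Xp Om Xm Op.
by case: a; case: b; rewrite /= ?mxE ?Xp ?Om ?Xm ?Op ?mul1n ?PoszM.
Qed.

(** The rows that close up around a helix: after one turn the row meets itself
shifted by [k] columns. *)
Definition helix_rows (p k : nat) : {set p.-tuple tile} :=
  [set s : p.-tuple tile | (map conn_right s == rot 1 (map conn_left s))
                        && (map conn_top s == rot k (map conn_bottom s))].

Lemma sum_row_count (p k : nat) (l : bool) :
  (\sum_(w : p.-tuple bool) row_count p l l w (rot k w) =
   #|[set s : p.-tuple tile | (l :: map conn_right s == rcons (map conn_left s) l)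
                   && (map conn_top s == rot k (map conn_bottom s))]|)%N.
Proof.
rewrite -sum1_card (partition_big (map_tuple conn_bottom) predT) //=.
apply: eq_bigr => w _; rewrite /row_count -sum1_card.
apply: eq_bigl => s; rewrite !inE -[_ == w]val_eqE /=.
rewrite -andbA; congr andb.
by case: (eqVneq (map conn_bottom s) w) => [->|]; rewrite ?andbT ?andbF.
Qed.

(** Summing over the word on the bottom edges, with the top edges forced to be its
rotation. The rows whose outer edges carry no connection point are counted by X,
the others by O. *)
Lemma shifted_traceE (p k : nat) :
  (0 < p)%N -> (k <= p)%N -> shifted_trace k (Xplus p + Oplus p) = #|helix_rows p k|%:Z.
Proof.
case: p => // p _ lekp; rewrite /shifted_trace.
rewrite (reindex (@word_ord p.+1)) /=; last exact/onW_bij/word_ord_bij.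
transitivity ((\sum_(w : p.+1.-tuple bool) row_count p.+1 false false w (rot k w))%N%:Z
  + (\sum_(w : p.+1.-tuple bool) row_count p.+1 true true w (rot k w))%N%:Z).
  rewrite -!natz -natrD -big_split /= natr_sum; apply: eq_bigr => w _.
  rewrite alpha_rot // natrD !natz mxE.
  by have [-> _ _ ->] := state_matrixE w (rot_tuple k w).
rewrite -PoszD !sum_row_count; congr Posz.
rewrite -cardsUI [X in (_ + X)%N]eq_card0 ?addn0; last first.
  move=> s; rewrite !inE; case/tupleP: s => t s /=.
  by rewrite !eqseq_cons; case: conn_left; rewrite ?andbF.
apply: eq_card => s; rewrite !inE; case/tupleP: s => t s /=.
by rewrite rot1_cons !eqseq_cons; case: conn_left; rewrite ?orbF.
Qed.

(** * Period mosaics on the torus and Burnside's lemma *)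

Lemma eq_ord_succ (n : nat) (j j' : 'I_n.+2) :
  (j' == j + 1) = (j' == j.+1 :> nat) || ((j' == 0 :> nat) && (j.+1 == n.+2 :> nat)).
Proof.
rewrite -val_eqE /= (modn_small (isT : 1 < n.+2)%N) addn1.
have := ltn_ord j; rewrite leq_eqVlt => /orP[/eqP Ej|ltj].
  by rewrite Ej modnn eqxx andbT; have := ltn_ord j'; rewrite ltn_neqAle => /andP[/negPf->].
by rewrite modn_small // (ltn_eqF ltj) andbF orbF.
Qed.

(** Suitable connectedness and suitable boundary connectedness together are one
condition on the torus, with indices in the ring of integers modulo [n + 2].
The size is at least 2 so that ['I_n.+2] is that ring. *)
Lemma period_mosaicP (n : nat) (M : mosaic n.+2 n.+2) :
  reflect (forall i j, conn_right (M i j) = conn_left (M i (j + 1))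
                    /\ conn_bottom (M i j) = conn_top (M (i + 1) j))
          (M \in period_mosaics n.+2 n.+2).
Proof.
rewrite inE; apply: (iffP idP) => [/andP[/andP[cH cV] /andP[bH bV]] i j|tM].
  split.
    have := eqxx (j + 1); rewrite {1}eq_ord_succ => /orP[Ej|/andP[Ej0 Ej]].
      by move/forallP/(_ i)/forallP/(_ j)/forallP/(_ (j + 1)): cH; rewrite Ej => /eqP.
    move/forallP/(_ i)/forallP/(_ (j + 1))/forallP/(_ j): bH.
    by rewrite Ej0 Ej => /eqP.
  have := eqxx (i + 1); rewrite {1}eq_ord_succ => /orP[Ei|/andP[Ei0 Ei]].
    by move/forallP/(_ i)/forallP/(_ (i + 1))/forallP/(_ j): cV; rewrite Ei => /eqP.
  move/forallP/(_ (i + 1))/forallP/(_ i)/forallP/(_ j): bV.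
  by rewrite Ei0 Ei => /eqP.
apply/andP; split; apply/andP; split;
  apply/forallP => i; apply/forallP => j; apply/forallP => j'; apply/implyP => E.
- have /eqP-> : j' == j + 1 by rewrite eq_ord_succ E.
  by rewrite (tM i j).1.
- have /eqP-> : j == i + 1 by rewrite eq_ord_succ E.
  by rewrite (tM i j').2.
- have /eqP-> : j == j' + 1 by rewrite eq_ord_succ E orbT.
  by rewrite (tM i j').1.
- have /eqP-> : i == j + 1 by rewrite eq_ord_succ E orbT.
  by rewrite (tM j j').2.
Qed.

Lemma cyc_sub_ord (n : nat) (i x : 'I_n.+2) : cyc_sub i x%:Z = i - x.
Proof.
apply: val_inj; rewrite /= modnDmr -modzDr.
have -> : i%:Z - x%:Z + n.+2%:Z = (i + (n.+2 - x))%N%:Z by have := ltn_ord x; lia.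
by rewrite modz_nat.
Qed.

Definition translate (n : nat) (M : mosaic n.+2 n.+2) (g : 'I_n.+2 * 'I_n.+2) :
  mosaic n.+2 n.+2 := \matrix_(i, j) M (i - g.1) (j - g.2).

Lemma rotate_translate (n : nat) (M : mosaic n.+2 n.+2) (x y : 'I_n.+2) :
  rotate x%:Z y%:Z M = translate M (x, y).
Proof. by apply/matrixP => i j; rewrite !mxE !cyc_sub_ord. Qed.

Lemma translate_is_action (n : nat) : is_action [set: 'I_n.+2 * 'I_n.+2] (@translate n).
Proof.
apply: is_total_action => [M|M g h]; apply/matrixP => i j; rewrite !mxE /=.
  (* The group law of ['I_n.+2] is its addition, with unit 0. *)
  by rewrite -[X in i - X]/0 -[X in j - X]/0 !subr0.
have subDE (a b c : 'I_n.+2) : c - (a + b) = c - b - a by rewrite opprD addrA addrAC.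
by congr (M _ _); apply: subDE.
Qed.

Canonical translation (n : nat) := Action (@translate_is_action n).

Lemma translate_period (n : nat) (M : mosaic n.+2 n.+2) g :
  (translate M g \in period_mosaics n.+2 n.+2) = (M \in period_mosaics n.+2 n.+2).
Proof.
apply/period_mosaicP/period_mosaicP => tM i j.
  by have := tM (i + g.1) (j + g.2); rewrite !mxE !(addrAC _ _ 1) !addrK.
by rewrite !mxE !(addrAC _ 1); apply: tM.
Qed.

Lemma toroidal_mosaicsE (n : nat) :
  toroidal_mosaics n.+2 n.+2 =
    orbit (translation n) [set: _] @: period_mosaics n.+2 n.+2.
Proof.
apply: eq_in_imset => M PM; apply/setP => N; rewrite !inE.
apply/andP/orbitP => [[_ /existsP[x /existsP[y /eqP->]]]|[[x y] _ <-]].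
  by exists (x, y); [rewrite inE | rewrite rotate_translate].
have := translate_period M (x, y); rewrite PM inE => ->; split=> //.
by apply/existsP; exists x; apply/existsP; exists y; rewrite rotate_translate.
Qed.

Definition fixed (n : nat) (g : 'I_n.+2 * 'I_n.+2) : {set mosaic n.+2 n.+2} :=
  [set M in period_mosaics n.+2 n.+2 | translate M g == M].

Lemma toroidal_burnside (n : nat) :
  (D_T n.+2 n.+2 * n.+2 ^ 2 = \sum_g #|fixed (n := n) g|)%N.
Proof.
have actsP : [acts [set: 'I_n.+2 * 'I_n.+2], on period_mosaics n.+2 n.+2 | translation n].
  by apply/actsP => g _ M; rewrite /= translate_period.
have := Frobenius_Cauchy actsP.
rewrite -toroidal_mosaicsE cardsT card_prod card_ord -mulnn => <-.
apply: eq_big => [g|g _]; first by rewrite inE.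
by apply: eq_card => M; rewrite !inE sub1set inE.
Qed.

(** * Mosaics fixed by a translation *)

Lemma fixedP (n : nat) (M : mosaic n.+2 n.+2) (x y : 'I_n.+2) :
  reflect (M \in period_mosaics n.+2 n.+2 /\ forall i j, M (i + x) (j + y) = M i j)
          (M \in fixed (x, y)).
Proof.
rewrite [M \in fixed _]in_set; apply: (iffP andP) => [[PM /eqP FM]|[PM FM]]; split=> //.
  by move=> i j; rewrite -[in LHS]FM mxE /= !addrK.
by apply/eqP/matrixP => i j; rewrite mxE -FM /= !subrK.
Qed.

Lemma fixed0 (n : nat) : fixed (0, 0) = period_mosaics n.+2 n.+2.
Proof.
apply/setP => M; apply/fixedP/idP => [[]|PM] //; split=> // i j.
by rewrite !addr0.
Qed.

Lemma fixedD (n : nat) (M : mosaic n.+2 n.+2) (x y x' y' : 'I_n.+2) :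
  M \in fixed (x, y) -> M \in fixed (x', y') -> M \in fixed (x + x', y + y').
Proof.
move=> /fixedP[PM FM] /fixedP[_ FM']; apply/fixedP; split=> // i j.
by rewrite !addrA FM' FM.
Qed.

Lemma fixedM (n : nat) (M : mosaic n.+2 n.+2) (c x y : 'I_n.+2) :
  M \in fixed (x, y) -> M \in fixed (c * x, c * y).
Proof.
move=> FM; rewrite -(natr_Zp c) !mulr_natl; elim: (nat_of_ord c) => [|k IHk].
  by rewrite !mulr0n fixed0; case/fixedP: FM.
by rewrite !mulrS; apply: fixedD.
Qed.

Lemma fixed_unit (n : nat) (c x y : 'I_n.+2) :
  c \is a GRing.unit -> fixed (c * x, c * y) = fixed (x, y).
Proof.
move=> Uc; apply/setP => M; apply/idP/idP; last exact: fixedM.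
by move/(fixedM c^-1); rewrite !mulKr.
Qed.

Lemma nth_rot (T : Type) (x0 : T) (k : nat) (s : seq T) (i : nat) :
  (k <= size s)%N -> (i < size s)%N -> nth x0 (rot k s) i = nth x0 s ((i + k) %% size s).
Proof.
move=> lek lti; rewrite /rot nth_cat size_drop nth_drop addnC ltn_subRL addnC.
case: ltnP => [ltik|geik]; first by rewrite modn_small.
rewrite nth_take; last by lia.
rewrite (_ : i + k = (i - (size s - k)) + size s)%N; last by lia.
by rewrite modnDr modn_small //; lia.
Qed.

Lemma rot_tupleP (n : nat) (f g : tile -> bool) (s : n.+2.-tuple tile) (k : 'I_n.+2) :
  reflect (forall j : 'I_n.+2, f (tnth s j) = g (tnth s (j + k)))
          (map f s == rot k (map g s)).
Proof.
have lek : (k <= size s)%N by rewrite size_tuple ltnW.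
have nthE j : nth false (rot k (map g s)) j = g (tnth s (inZp (j + k))) \/ (n.+2 <= j)%N.
  case: (ltnP j n.+2) => [ltj|]; [left|by right].
  rewrite nth_rot ?size_map ?size_tuple ?(ltnW (ltn_ord k)) //.
  by rewrite (nth_map ord0) ?size_tuple ?ltn_pmod // (tnth_nth ord0).
apply: (iffP eqP) => [E j|E].
  have := congr1 (fun w => nth false w j) E; rewrite (nth_map ord0) ?size_tuple //.
  case: (nthE j) => [->|]; last by rewrite leqNgt ltn_ord.
  rewrite -tnth_nth => ->; congr (g (tnth s _)); apply: val_inj => //.
apply: (@eq_from_nth _ false) => [|j]; rewrite ?size_rot ?size_map // size_tuple => ltj.
rewrite (nth_map ord0) ?size_tuple //; case: (nthE j) => [->|]; last by rewrite leqNgt ltj.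
have := E (Ordinal ltj); rewrite (tnth_nth ord0) /= => ->.
by congr (g (tnth s _)); apply: val_inj.
Qed.

(** A mosaic fixed by [(1, y)] is recovered from its row 0 by
[M i j = M 0 (j - y * i)]. *)
Lemma card_fixed_helix (n : nat) (y : 'I_n.+2) :
  #|fixed (1, y)| = #|helix_rows n.+2 y|.
Proof.
pose unroll (s : n.+2.-tuple tile) : mosaic n.+2 n.+2 :=
  \matrix_(i, j) tnth s (j - y * i).
have unroll_inj : injective unroll.
  move=> s s' /matrixP E; apply: eq_from_tnth => j.
  by have := E 0 j; rewrite !mxE mulr0 subr0.
rewrite -(card_imset _ unroll_inj); congr #|pred_of_set _|; apply/setP => M.
have helixP (s : n.+2.-tuple tile) :
    reflect (forall j, conn_right (tnth s j) = conn_left (tnth s (j + 1))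
              /\ conn_top (tnth s j) = conn_bottom (tnth s (j + y))) (s \in helix_rows n.+2 y).
  rewrite inE -[1%N]/(nat_of_ord (1 : 'I_n.+2)).
  apply: (iffP andP) => [[/rot_tupleP H /rot_tupleP V] j|HV]; first by rewrite H V.
  by split; apply/rot_tupleP => j; case: (HV j).
apply/fixedP/imsetP => [[/period_mosaicP PM FM]|[s /helixP Hs ->]].
  have ME i j : M i j = M 0 (j - y * i).
    have [|_ /(_ 0 (j - y * i))] := fixedP M i (i * y) _.
      by rewrite -[i in (i, _)]mulr1; apply: fixedM; apply/fixedP; split=> //; apply/period_mosaicP.
    by rewrite add0r mulrC subrK.
  exists [tuple M 0 j | j < n.+2].
    apply/helixP => j; rewrite !tnth_mktuple; split; first by rewrite (PM 0 j).1.
    by rewrite (PM 0 (j + y)).2 [in RHS]ME add0r mulr1 addrK.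
  by apply/matrixP => i j; rewrite !mxE tnth_mktuple -ME.
split=> [|i j]; last by rewrite !mxE; congr (tnth s _); ring.
apply/period_mosaicP => i j; rewrite !mxE; split.
  by rewrite (Hs _).1 addrAC.
by rewrite (Hs (j - y * (i + 1))).2; congr (conn_bottom (tnth s _)); ring.
Qed.

(** * Symmetries between directions *)

(** The tile with the two coordinate axes exchanged, as far as connection points are
concerned: left and top are exchanged, and right and bottom. *)
Definition tile_transpose (t : tile) : tile :=
  match val t with
  | 1 => Ordinal (isT : 3 < 11)%N
  | 3 => Ordinal (isT : 1 < 11)%N
  | 5 => Ordinal (isT : 6 < 11)%N
  | 6 => Ordinal (isT : 5 < 11)%N
  | _ => t
  end.

Lemma tile_transposeK : involutive tile_transpose.
Proof. by move=> t; apply: val_inj; case: t; do 11?[case=> //]. Qed.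

Lemma conn_transpose (t : tile) :
  [/\ conn_left (tile_transpose t) = conn_top t,
      conn_right (tile_transpose t) = conn_bottom t,
      conn_top (tile_transpose t) = conn_left t
    & conn_bottom (tile_transpose t) = conn_right t].
Proof. by case: t; do 11?[case=> //]. Qed.

(** Top and bottom are exchanged. *)
Definition tile_flip (t : tile) : tile :=
  match val t with
  | 1 => Ordinal (isT : 4 < 11)%N
  | 2 => Ordinal (isT : 3 < 11)%N
  | 3 => Ordinal (isT : 2 < 11)%N
  | 4 => Ordinal (isT : 1 < 11)%N
  | _ => t
  end.

Lemma tile_flipK : involutive tile_flip.
Proof. by move=> t; apply: val_inj; case: t; do 11?[case=> //]. Qed.

Lemma conn_flip (t : tile) :
  [/\ conn_left (tile_flip t) = conn_left t,
      conn_right (tile_flip t) = conn_right t,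
      conn_top (tile_flip t) = conn_bottom t
    & conn_bottom (tile_flip t) = conn_top t].
Proof. by case: t; do 11?[case=> //]. Qed.

Lemma card_fixed_transpose (n : nat) (x y : 'I_n.+2) :
  #|fixed (x, y)| = #|fixed (y, x)|.
Proof.
wlog suff le : x y / (#|fixed (x, y)| <= #|fixed (y, x)|)%N.
  by apply/eqP; rewrite eqn_leq !le.
pose tr (M : mosaic n.+2 n.+2) := \matrix_(i, j) tile_transpose (M j i).
have tr_inj : injective tr.
  move=> M N /matrixP E; apply/matrixP => i j.
  by have := E j i; rewrite !mxE => /(can_inj tile_transposeK).
rewrite -(card_imset _ tr_inj); apply/subset_leq_card/subsetP => _ /imsetP[M /fixedP[PM FM] ->].
apply/fixedP; split=> [|i j]; last by rewrite !mxE FM.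
apply/period_mosaicP => i j; rewrite !mxE.
have [El Er Et Eb] := conn_transpose (M j i).
have [_ [Er' Eb']] := (tt, elimT (period_mosaicP M) PM j i).
by rewrite Er Eb Eb' Er'; have [-> _ _ _] := conn_transpose (M (j + 1) i);
   have [_ _ -> _] := conn_transpose (M j (i + 1)).
Qed.

Lemma card_fixed_opp (n : nat) (y : 'I_n.+2) : #|fixed (1, - y)| = #|fixed (1, y)|.
Proof.
wlog suff le : y / (#|fixed (1, y)%R| <= #|fixed (1, - y)%R|)%N.
  by apply/eqP; rewrite eqn_leq le andbT -[X in (_ <= #|fixed (_, X)%R|)%N]opprK.
pose fl (M : mosaic n.+2 n.+2) := \matrix_(i, j) tile_flip (M (- i) j).
have fl_inj : injective fl.
  move=> M N /matrixP E; apply/matrixP => i j.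
  by have := E (- i) j; rewrite !mxE opprK => /(can_inj tile_flipK).
rewrite -(card_imset _ fl_inj); apply/subset_leq_card/subsetP => _ /imsetP[M /fixedP[PM FM] ->].
apply/fixedP; split=> [|i j]; last first.
  by rewrite !mxE -[in LHS]FM opprD !subrK.
apply/period_mosaicP => i j; rewrite !mxE.
have [_ -> _ ->] := conn_flip (M (- i) j).
have [-> _ _ _] := conn_flip (M (- i) (j + 1)).
have [_ _ -> _] := conn_flip (M (- (i + 1)) j).
split; first by rewrite (elimT (period_mosaicP M) PM _ _).1.
by rewrite (elimT (period_mosaicP M) PM _ _).2 opprD subrK.
Qed.

(** * Summing over the directions for a prime size *)

Lemma unit_ord_prime (n : nat) (x : 'I_n.+2) :
  prime n.+2 -> (x \is a GRing.unit) = (x != 0).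
Proof.
move=> p_pr; rewrite -[x in LHS]natr_Zp.
rewrite [LHS](unitZpE x (isT : 1 < n.+2)%N) prime_coprime // -val_eqE /=.
case: posnP => [->|x_gt0]; first by rewrite dvdn0.
by rewrite gtnNdvd // -lt0n x_gt0.
Qed.

(** The points of the projective line over Z/p: for [p] prime, each subgroup of
order [p] of the translation group is generated by exactly one of these. *)
Definition direction (n : nat) (d : option 'I_n.+2) : 'I_n.+2 * 'I_n.+2 :=
  if d is Some y then (1, y) else (0, 1).

Lemma sum_direction (n : nat) (F : 'I_n.+2 * 'I_n.+2 -> nat) :
  (\sum_(d : option 'I_n.+2) F (direction d) = F (0, 1)%R + \sum_y F (1%R, y))%N.
Proof.
rewrite (bigD1 None) //=; congr addn.
rewrite (reindex_omap Some id) => [|[y|]] //=.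
by apply: eq_bigl => y; rewrite eqxx.
Qed.

(** If [x] is nonzero then [(x, y) = x (1, y / x)] and [x] is invertible, so for
fixed [x] the sum over [y] is the sum over the directions [(1, z)]. If [x] is zero
and [y] is not, then [(x, y)] is a multiple of [(0, 1)]. Each direction thus occurs
[p - 1] times. *)
Lemma sum_card_fixed (n : nat) : prime n.+2 ->
  (\sum_g #|fixed (n := n) g| =
     D_P n.+2 n.+2 + n.+1 * \sum_(d : option 'I_n.+2) #|fixed (direction d)|)%N.
Proof.
move=> p_pr; rewrite (sum_direction (fun g => #|fixed g|)) mulnDr.
have sum_nonzero c : (\sum_(x : 'I_n.+2 | x != 0%R) c = n.+1 * c)%N.
  by rewrite sum_nat_const (eq_card (B := predC1 0)) // cardC1 card_ord.
rewrite (eq_bigr (fun g => #|fixed (g.1, g.2)|)); last by case.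
rewrite -(pair_bigA _ (fun x y => #|fixed (x, y)|)) /= (bigD1 0) //= addnA.
congr addn.
  rewrite (bigD1 0) //= fixed0; congr addn.
  rewrite -sum_nonzero; apply: eq_bigr => y y_neq0.
  by rewrite -(fixed_unit 0 1 (c := y)) ?unit_ord_prime // mulr0 mulr1.
rewrite -sum_nonzero; apply: eq_bigr => x x_neq0.
have Ux : x \is a GRing.unit by rewrite unit_ord_prime.
rewrite (reindex (fun y => x * y)) /=; last first.
  by exists (fun y => x^-1 * y) => y _; rewrite (mulKr, mulVKr).
by apply: eq_bigr => y _; rewrite -(fixed_unit 1 y Ux) mulr1.
Qed.

Lemma sum_reflect (h : nat) (c : nat -> nat) :
  (forall k, k < 2 * h + 1 -> 0 < k -> c (2 * h + 1 - k) = c k)%N ->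
  (c 0 + \sum_(0 <= k < 2 * h + 1) c k = 2 * \sum_(0 <= k < h.+1) c k)%N.
Proof.
move=> cK; rewrite (big_cat_nat (n := h.+1)) //; last by lia.
rewrite addnCA [RHS]mul2n -addnn; congr addn.
rewrite -{1}[h.+1]add0n big_addn [in RHS]big_nat_recl //.
rewrite (_ : 2 * h + 1 - h.+1 = h)%N; last by lia.
rewrite big_nat_rev; congr addn; apply: eq_big_nat => k /andP[_ ltk].
by rewrite -cK; [congr c | |]; lia.
Qed.

(** The term for [k = 0] occurs for the direction [(1, 0)] and for its transpose
[(0, 1)], and the term for [k > 0] for the directions [(1, k)] and [(1, - k)]. *)
Lemma sum_fixed_direction (n : nat) : odd n.+2 ->
  (\sum_(d : option 'I_n.+2) #|fixed (direction d)| =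
     2 * \sum_(0 <= k < ((n.+2 - 1) %/ 2).+1) #|helix_rows n.+2 k|)%N.
Proof.
move=> p_odd; rewrite (sum_direction (fun g => #|fixed g|)) card_fixed_transpose card_fixed_helix.
have Ep : (n.+2 = 2 * ((n.+2 - 1) %/ 2) + 1)%N by have := p_odd; lia.
rewrite -sum_reflect -?Ep => [|k ltk k_gt0]; last first.
  pose y : 'I_n.+2 := Ordinal ltk.
  have EN : (n.+2 - k)%N = nat_of_ord (- y) by rewrite /= modn_small //; lia.
  by rewrite EN -card_fixed_helix card_fixed_opp card_fixed_helix.
by congr addn; rewrite big_mkord; apply: eq_bigr => y _; rewrite card_fixed_helix.
Qed.

(** * Constant mosaics and positivity *)

Definition constants (n : nat) : {set mosaic n.+2 n.+2} :=
  [set const_mx t | t : tile & (conn_right t == conn_left t) && (conn_bottom t == conn_top t)].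

(** The tiles are T_0 and T_5, ..., T_10. *)
Lemma card_constants (n : nat) : #|constants n| = 7%N.
Proof.
rewrite /constants card_imset; last first.
  by move=> t t' /matrixP/(_ 0 0); rewrite !mxE.
by rewrite -sum1_card big_mkcond /= !big_ord_recl big_ord0 !inE.
Qed.

Lemma fixed_all (n : nat) (M : mosaic n.+2 n.+2) (x y : 'I_n.+2) :
  M \in fixed (1, 0) -> M \in fixed (0, 1) -> M \in fixed (x, y).
Proof.
move=> Fx Fy; have := fixedD (fixedM x Fx) (fixedM y Fy).
by rewrite !mulr1 !mulr0 addr0 add0r.
Qed.

Lemma constantsP (n : nat) (M : mosaic n.+2 n.+2) :
  reflect (M \in fixed (1, 0) /\ M \in fixed (0, 1)) (M \in constants n).
Proof.
apply: (iffP imsetP) => [[t + ->]|[Fx Fy]].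
  rewrite inE => /andP[/eqP H /eqP V].
  by split; apply/fixedP; split=> [|i j]; rewrite ?mxE //;
    apply/period_mosaicP => i j; rewrite !mxE.
have ME i j : M i j = M 0 0.
  by have /fixedP[_ /(_ 0 0)] := fixed_all i j Fx Fy; rewrite !add0r.
exists (M 0 0); last by apply/matrixP => i j; rewrite mxE ME.
have /fixedP[/period_mosaicP PM _] := Fx; have [H V] := PM 0 0.
by rewrite inE H V !(ME _ (_ + 1)) !(ME (_ + 1)) !eqxx.
Qed.

(** T_7 and T_8 have connection points on all edges, so they can be placed
arbitrarily; this gives mosaics with any prescribed stabilizer. *)
Definition two_colored (n : nat) (A : 'I_n.+2 -> 'I_n.+2 -> bool) : mosaic n.+2 n.+2 :=
  \matrix_(i, j) if A i j then Ordinal (isT : 7 < 11)%N else Ordinal (isT : 8 < 11)%N.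

Lemma two_colored_period (n : nat) (A : 'I_n.+2 -> 'I_n.+2 -> bool) :
  two_colored A \in period_mosaics n.+2 n.+2.
Proof. by apply/period_mosaicP => i j; rewrite !mxE; do 3?case: ifP. Qed.

Lemma two_colored_fixedP (n : nat) (A : 'I_n.+2 -> 'I_n.+2 -> bool) (x y : 'I_n.+2) :
  reflect (forall i j, A (i + x) (j + y) = A i j) (two_colored A \in fixed (x, y)).
Proof.
apply: (iffP (fixedP _ _ _)) => [[_ F] i j|F]; last first.
  by split=> [|i j]; [apply: two_colored_period | rewrite !mxE F].
by have := F i j; rewrite !mxE; case: (A _ _); case: (A _ _).
Qed.

Lemma direction_neq0 (n : nat) (d : option 'I_n.+2) : direction d != (0, 0).
Proof. by case: d. Qed.

Lemma constants_fixed (n : nat) (x y : 'I_n.+2) : constants n \subset fixed (x, y).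
Proof.
by apply/subsetP => M /constantsP[Fx Fy]; apply: fixed_all.
Qed.

Lemma helix_rows_gt7 (n : nat) (y : 'I_n.+2) : (7 < #|helix_rows n.+2 y|)%N.
Proof.
have /proper_card : constants n \proper fixed (1, y).
  apply/properP; split; first exact: constants_fixed.
  (* A single helix of T_7 in the direction (1, y), among T_8. *)
  pose A (i j : 'I_n.+2) := j == y * i.
  exists (two_colored A).
    apply/two_colored_fixedP => i j; rewrite /A mulrDr mulr1.
    by rewrite (inj_eq (addIr y)).
  apply/constantsP => -[_ /two_colored_fixedP /(_ 0 0)].
  by rewrite /A !add0r mulr0 eqxx.
by rewrite card_constants card_fixed_helix.
Qed.

(** Two different directions span the whole translation group. *)
Lemma fixed_two_directions (n : nat) (M : mosaic n.+2 n.+2) (d d' : option 'I_n.+2) :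
  prime n.+2 -> d != d' -> M \in fixed (direction d) -> M \in fixed (direction d') ->
  M \in constants n.
Proof.
move=> p_pr.
have vertical y : M \in fixed (1, y) -> M \in fixed (0, 1) -> M \in constants n.
  move=> F1 F0; apply/constantsP; split=> //.
  by have := fixedD F1 (fixedM (- y) F0); rewrite mulr0 addr0 mulr1 subrr.
case: d d' => [y|] [y'|] neq_d F F'; last by rewrite eqxx in neq_d.
- have Uyy : y - y' \is a GRing.unit.
    by rewrite unit_ord_prime // subr_eq0; apply: contraNneq neq_d => ->.
  have := fixedD F (fixedM (-1) F'); rewrite /= mulr1 subrr mulN1r.
  rewrite (_ : fixed (0, y - y') = fixed (0, 1)); first by apply: (vertical y).
  by rewrite -(fixed_unit 0 1 Uyy) mulr0 mulr1.
- exact: vertical F F'.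
exact: vertical F' F.
Qed.

(** By [fixed_two_directions], the constant mosaics and, for each direction, the
non-constant mosaics fixed by it are pairwise disjoint sets; none of them contains
the mosaic with a single T_7 among T_8. This is the positivity of [d_sq]. *)
Lemma period_mosaics_gt (n : nat) : prime n.+2 ->
  (7 + \sum_(d : option 'I_n.+2) #|fixed (direction d)| < D_P n.+2 n.+2 + n.+3 * 7)%N.
Proof.
move=> p_pr; pose u := two_colored (fun i j : 'I_n.+2 => (i, j) == (0, 0)).
have Pu : u \in period_mosaics n.+2 n.+2 by apply: two_colored_period.
have u_free d : u \notin fixed (direction d).
  case Ed: (direction d) => [x y]; apply/two_colored_fixedP => /(_ 0 0).
  by rewrite !add0r eqxx; apply/negP; rewrite -Ed direction_neq0.
have cardD d : (#|fixed (direction d)| = 7 + #|fixed (direction d) :\: constants n|)%N.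
  case: (direction d) => x y; rewrite -(cardsID (constants n) (fixed (x, y))).
  by rewrite (setIidPr (constants_fixed x y)) card_constants.
under eq_bigr do rewrite cardD.
rewrite big_split sum_nat_const card_option card_ord addnCA addnC ltn_add2r.
rewrite /D_P (cardsD1 u) Pu add1n ltnS.
(* The [p + 2] disjoint sets: [None] for the constants, [Some d] for [d]. *)
pose K (o : option (option 'I_n.+2)) : {set mosaic n.+2 n.+2} :=
  if o is Some d then fixed (direction d) :\: constants n else constants n.
have -> : (7 + \sum_d #|fixed (direction d) :\: constants n| = \sum_o #|K o|)%N.
  rewrite [RHS](bigD1 None) //= card_constants; congr addn.
  rewrite [RHS](reindex_omap Some id) => [|[d|]] //=.
  by apply: eq_bigl => d; rewrite eqxx.
rewrite -[X in (_ <= X)%N]sum1_card.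
rewrite (eq_bigr (fun o => \sum_(M | M \in K o) 1)%N) => [|o _]; last by rewrite sum1_card.
rewrite (exchange_big_dep (fun M => M \in period_mosaics n.+2 n.+2 :\ u)) /=; last first.
  move=> o M _ KM; rewrite in_setD1; case: o KM => [d|] /=.
    rewrite in_setD => /andP[_ FM]; apply/andP; split.
      by apply: contraNneq (u_free d) => <-.
    by case: (direction d) FM => x y /fixedP[].
  move=> /constantsP[_ FM]; apply/andP; split; last by case/fixedP: FM.
  by apply: contraNneq (u_free None) => <-.
apply: leq_sum => M _; rewrite sum1_card; apply/card_le1P => o.
rewrite -[o \in _]/(M \in K o) => KM o'.
rewrite [RHS]inE -[LHS]/(M \in K o'); apply/idP/eqP => [KM'|->] //.
case: o o' KM KM' => [d|] [d'|] //=; rewrite ?in_setD.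
- move=> /andP[NC F] /andP[_ F']; congr Some; apply/eqP; apply: contraNT NC => neq_d.
  exact: fixed_two_directions F' F.
- by move=> /andP[/negPf->].
- by move=> CM /andP[/negP].
Qed.

(** * The size 2 *)

(** As [insub_eq], unlike [insub], reduces to a value, sums over this list can be
evaluated. *)
Definition all_tiles : seq tile := pmap (insub_eq 'I_11) (iota 0 11).

Definition sum_tiles (f : tile -> nat) : nat := sumn (map f all_tiles).

Lemma sum_tilesE (f : tile -> nat) : (\sum_t f t = sum_tiles f)%N.
Proof.
rewrite /sum_tiles sumnE big_map /all_tiles (eq_pmap (insub_eqE _)).
apply/perm_big/uniq_perm; rewrite ?index_enum_uniq ?(ord_enum_uniq 11) // => t.
by rewrite mem_index_enum (mem_ord_enum t).
Qed.

Lemma forall_ord2 (P : 'I_2 -> Prop) : P 0 -> P 1 -> forall i, P i.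
Proof.
move=> P0 P1 [[|[|//]] lti].
  by rewrite (_ : Ordinal lti = 0) //; apply: val_inj.
by rewrite (_ : Ordinal lti = 1) //; apply: val_inj.
Qed.

Lemma card_mosaic22 (A : {set mosaic 2 2}) (F : tile -> tile -> tile -> tile -> bool) :
  (forall M : mosaic 2 2, (M \in A) = F (M 0 0) (M 0 1) (M 1 0) (M 1 1)) ->
  #|A| = sum_tiles (fun a => sum_tiles (fun b =>
           sum_tiles (fun c => sum_tiles (fun d => F a b c d)))).
Proof.
move=> AF; rewrite -sum1_card big_mkcond /=.
pose mk (x : (tile * tile) * (tile * tile)) : mosaic 2 2 :=
  \matrix_(i, j) if i == 0 then if j == 0 then x.1.1 else x.1.2
                 else if j == 0 then x.2.1 else x.2.2.
have mk_bij : bijective mk.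
  exists (fun M : mosaic 2 2 => ((M 0 0, M 0 1), (M 1 0, M 1 1))) => [[[a b] [c d]]|M].
    by rewrite !mxE.
  by apply/matrixP; do 2!apply: forall_ord2; rewrite !mxE.
rewrite (reindex mk) /=; last exact: onW_bij.
rewrite -(pair_bigA _ (fun x y => if mk (x, y) \in A then 1 else 0)%N) /=.
rewrite -(pair_bigA _ (fun a b => \sum_y if mk ((a, b), y) \in A then 1 else 0)%N) /=.
rewrite -sum_tilesE; apply: eq_bigr => a _; rewrite -sum_tilesE; apply: eq_bigr => b _.
rewrite -(pair_bigA _ (fun c d => if mk ((a, b), (c, d)) \in A then 1 else 0)%N) /=.
rewrite -sum_tilesE; apply: eq_bigr => c _; rewrite -sum_tilesE; apply: eq_bigr => d _.
by rewrite AF !mxE; case: (F _ _ _ _).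
Qed.

Definition torus22 (a b c d : tile) : bool :=
  [&& conn_right a == conn_left b, conn_right b == conn_left a,
      conn_bottom a == conn_top c, conn_bottom c == conn_top a,
      conn_right c == conn_left d, conn_right d == conn_left c,
      conn_bottom b == conn_top d & conn_bottom d == conn_top b].

Lemma period22 (M : mosaic 2 2) :
  (M \in period_mosaics 2 2) = torus22 (M 0 0) (M 0 1) (M 1 0) (M 1 1).
Proof.
have E0 : (0 + 1 : 'I_2) = 1 by apply: val_inj.
have E1 : (1 + 1 : 'I_2) = 0 by apply: val_inj.
apply/period_mosaicP/idP => [PM|].
  have [H00 V00] := PM 0 0; have [H01 V01] := PM 0 1.
  have [H10 V10] := PM 1 0; have [H11 V11] := PM 1 1.
  by rewrite /torus22 H00 V00 H01 V01 H10 V10 H11 V11 ?E0 ?E1 !eqxx.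
do 7![case/andP=> /eqP ?] => /eqP ?.
by do 2!apply: forall_ord2; rewrite ?E0 ?E1; split.
Qed.

Lemma fixed22 (g : 'I_2 * 'I_2) (M : mosaic 2 2) :
  (M \in fixed g) = [&& torus22 (M 0 0) (M 0 1) (M 1 0) (M 1 1),
    M (- g.1) (- g.2) == M 0 0, M (- g.1) (1 - g.2) == M 0 1,
    M (1 - g.1) (- g.2) == M 1 0 & M (1 - g.1) (1 - g.2) == M 1 1].
Proof.
rewrite [LHS]in_set period22; congr andb.
apply/eqP/idP => [/matrixP E|/and4P[/eqP E1 /eqP E2 /eqP E3 /eqP E4]].
  by rewrite -(E 0 0) -(E 0 1) -(E 1 0) -(E 1 1) !mxE !sub0r !eqxx.
by apply/matrixP; do 2!apply: forall_ord2; rewrite mxE ?sub0r.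
Qed.

Lemma D_T22 : D_T 2 2 = 110%N.
Proof.
have N1 : (- 1 : 'I_2) = 1 by apply: val_inj.
have E1 : (1 + 1 : 'I_2) = 0 by apply: val_inj.
have card01 : #|fixed (0 : 'I_2, 1 : 'I_2)| = 29%N.
  rewrite (card_mosaic22 (F := fun a b c d =>
    [&& torus22 a b c d, b == a, a == b, d == c & c == d])) => [|M].
    by vm_compute.
  by rewrite fixed22 /= oppr0 !addr0 N1 E1.
have card11 : #|fixed (1 : 'I_2, 1 : 'I_2)| = 23%N.
  rewrite (card_mosaic22 (F := fun a b c d =>
    [&& torus22 a b c d, d == a, c == b, b == c & a == d])) => [|M].
    by vm_compute.
  by rewrite fixed22 /= N1 E1.
have := toroidal_burnside 0; rewrite sum_card_fixed //.
rewrite (sum_direction (fun g => #|fixed g|)) mul1n.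
have -> : (\sum_(y : 'I_2) #|fixed (n := 0) (1, y)%R| =
            #|fixed (n := 0) (1, 0)%R| + #|fixed (n := 0) (1, 1)%R|)%N.
  by rewrite big_ord_recl big_ord1; congr (_ + #|fixed (_, _)|)%N; apply: val_inj.
rewrite (card_fixed_transpose 1 0) card01 card11 /D_P (card_mosaic22 period22).
have -> : sum_tiles (fun a => sum_tiles (fun b =>
           sum_tiles (fun c => sum_tiles (fun d => torus22 a b c d)))) = 359%N.
  by vm_compute.
by lia.
Qed.

(** * The theorem *)

Theorem theorem4 :
  D_T 2 2 = 110%N
  /\ forall p : nat, prime p -> (3 <= p)%N ->
     [/\ forall k : nat, (k <= (p - 1) %/ 2)%N -> 0 < d_k1 p k,
         0 < d_sq p
       & (D_T p p)%:R =
           1 / (p%:R ^+ 2) * (d_sq p)%:~R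
           + 2 / p%:R * (\sum_(0 <= k < ((p - 1) %/ 2).+1) (d_k1 p k)%:~R)
           + 7 :> rat].
Proof.
split=> [|p p_pr p_ge3]; first exact: D_T22.
case: p p_pr p_ge3 => [|[|n]] // p_pr p_ge3.
have p_odd : odd n.+2 by case: (even_prime p_pr) p_ge3 => // ->.
set h := ((n.+2 - 1) %/ 2)%N.
have Eh : (n.+1 = 2 * h)%N by have := p_odd; rewrite /h; lia.
have dE k : (k <= h)%N -> d_k1 n.+2 k = #|helix_rows n.+2 k|%:Z - 7.
  by move=> lek; rewrite /d_k1 shifted_traceE //; lia.
have gt7 k : (k <= h)%N -> (7 < #|helix_rows n.+2 k|)%N.
  move=> lek; have ltk : (k < n.+2)%N by lia.
  exact: (helix_rows_gt7 (Ordinal ltk)).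
pose c := (\sum_(0 <= k < h.+1) #|helix_rows n.+2 k|)%N.
have Ed : \sum_(0 <= k < h.+1) d_k1 n.+2 k = c%:Z - 7 * (h.+1)%:Z.
  rewrite (eq_big_nat _ _ (F2 := fun k => #|helix_rows n.+2 k|%:Z - 7)); last first.
    by move=> k /andP[_ ltk]; rewrite dE.
  rewrite sumrB /c big_const_nat iter_addr_0 -[c%:Z]natz natr_sum.
  congr (_ - _); first by apply: eq_bigr => k _; rewrite natz.
  by rewrite subn0 -[h.+1%:Z]natz mulr_natr.
have Esum : (\sum_(d : option 'I_n.+2) #|fixed (direction d)| = 2 * c)%N.
  exact: sum_fixed_direction.
split.
- by move=> k lek; rewrite dE // subr_gt0 ltz_nat gt7.
- have := period_mosaics_gt p_pr; rewrite Esum /d_sq -/h Ed; lia.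
have Burnside := toroidal_burnside n; rewrite sum_card_fixed // Esum in Burnside.
rewrite -rmorph_sum /= Ed /d_sq -/h Ed.
have p_neq0 : 2 * h%:R + 1 != 0 :> rat by rewrite -natrM natr1 pnatr_eq0.
have En : n.+1%:R = 2 * h%:R :> rat by rewrite Eh natrM.
have EP : n.+2%:R = 2 * h%:R + 1 :> rat by rewrite -natr1 En.
move/(congr1 (fun m => m%:R : rat)): Burnside.
rewrite natrM natrX natrD !natrM EP En => Burnside.
rewrite !(rmorphB, rmorphM) /= -!pmulrn -[h.+1%:R]natr1.
have -> : (D_T n.+2 n.+2)%:R =
    ((D_P n.+2 n.+2)%:R + 2 * h%:R * (2 * c%:R)) / (2 * h%:R + 1) ^+ 2 :> rat.
  by rewrite -Burnside mulfK // expf_neq0.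
by field.
Qed.
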